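(* Let $n\ge3$, let $i$ be an inner vertex ($2\le i\le n-1$), and let $\phi\in\mathcal{F}_n^{\mathbb{Z}}$ be an integer flow for which $\phi'=m_i^+(\phi)$ is defined. The two simplices in $\mathcal{T}_n^{\mathrm{LRL}}$ corresponding to $\phi$ and $\phi'$ are adjacent in $D(\mathcal{T}_n^{\mathrm{LRL}})$ if and only if the sequence of offsets $\mathbf{z}^{(i)}(\phi)$ of $\phi$ at $i$ contains no zeroes.
   Context: The contracted zigzag graph $G_n$ (written $\widehat{\mathrm{Zig}}_n$) is the directed multigraph with vertices $1,\dots,n$ and edges $x_i=(i,i+1)$ for $1\le i\le n-1$ (slack edges), $y_0=(1,2)$, $y_i=(i,i+2)$ for $1\le i\le n-2$, and $y_{n-1}=(n-1,n)$ (nonslack edges). The inner vertices are $2,\dots,n-1$. Each inner vertex $i$ has incoming edges $\{x_{i-1},y_{i-2}\}$ and outgoing edges $\{x_i,y_i\}$. The length-reverse-length (LRL) framing orders them by $y_{i-2}\prec x_{i-1}$ (incoming) and $x_i\prec y_i$ (outgoing) at every inner vertex $i$. A route is a directed path from $1$ to $n$; a prefix at $i$ is a directed path from $1$ to $i$; a suffix at $i$ is a directed path from $i$ to $n$. Paths are sequences of edges (parallel edges are distinguished). For distinct prefixes $P,P'$ at an inner vertex $i$, let $j\le i$ be the vertex after which they coincide and which they enter along different edges $e$ (of $P$) and $e'$ (of $P'$); set $P\prec P'$ if $e\prec e'$ in the incoming order at $j$. For distinct suffixes $Q,Q'$ at $i$, let $k\ge i$ be the first vertex which they leave along different edges $e$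 (of $Q$), $e'$ (of $Q'$); set $Q\prec Q'$ if $e\prec e'$ in the outgoing order at $k$. Two routes $R=PiQ$ and $R'=P'iQ'$ through a common inner vertex $i$ (with prefixes $P,P'$ and suffixes $Q,Q'$ at $i$) conflict at $i$ if the prefixes and suffixes are oppositely ordered ($P\prec P'$ and $Q'\prec Q$, or vice versa). A maximal clique is an inclusion-maximal set of routes no two of which conflict at any vertex. Each route is identified with its 0/1 indicator vector in $\mathbb{R}^{E(G_n)}$, a vertex of the flow polytope of nonnegative unit flows from $1$ to $n$. For a maximal clique $C$, $\Delta_C$ is the convex hull of its routes; the $\Delta_C$ are the maximal simplices of a regular unimodular triangulation of this flow polytope (Danilov–Karzanov–Koshevoy). $\mathcal{T}_n^{\mathrm{LRL}}$ denotes the set of these simplices. Two simplices are adjacent if they share a codimension 1 face, equivalently if their maximal cliques differ by exactly one route. The dual graph $D(\mathcal{T}_n^{\mathrm{LRL}})$ has vertex set $\mathcal{T}_n^{\mathrm{LRL}}$ and an edge between each pair of adjacent simplices. $\mathcal{F}_n^{\mathbb{Z}}$ is the set of functions $\phi:E(G_n)\to\mathbb{Z}_{\ge0}$ with $\sum_{e\text{ into }i}\phi(e)+d_i=\sum_{e\text{ out of }i}\phi(e)$ for every vertex $i$, where $(d_1,\dots,d_n)=(0,1,1,\dots,1,-(n-2))$. There is a bijection (Mészáros–Morales–Striker) $\Delta_C\mapsto\phi(\Delta_C)$ from $\mathcal{T}_n^{\mathrm{LRL}}$ to $\mathcal{F}_n^{\mathbb{Z}}$: $\phi(\Delta_C)(e)=0$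 if $e$ leaves vertex $1$, and if $e$ leaves an inner vertex $i$, then $\phi(\Delta_C)(e)$ is one less than the number of prefixes $P$ at $i$ such that some route of $C$ begins with $P$ followed by $e$. ''Corresponding'' refers to this bijection. Elementary move $m_i^+$ on $\mathcal{F}_n^{\mathbb{Z}}$, for $2\le i\le n-1$: if $\phi(x_i)>0$ and $\phi(y_{i+1})>0$, then $m_i^+(\phi)$ is the flow obtained by subtracting one from $\phi(x_i)$ and $\phi(y_{i+1})$ and adding one to $\phi(x_{i+2})$ and $\phi(y_i)$; otherwise $m_i^+(\phi)$ is not defined. When $i\in\{n-2,n-1\}$, all conditions and operations involving the nonexistent values $\phi(x_n),\phi(y_n),\phi(x_{n+1})$ are ignored. Sequence of offsets of a flow $\phi\in\mathcal{F}_n^{\mathbb{Z}}$ at $i$, $\mathbf{z}^{(i)}(\phi)=(z_{i+1},\dots,z_{n-1})$, with entries in $\mathbb{Z}\cup\{\varnothing\}$: if $i=n-1$ it is the empty sequence. Otherwise set $z_{i+1}=\phi(y_{i+1})$. As long as some entry is not defined, take the largest index $j$ for which $z_j$ is an already computed integer and: if $z_j<0$, set $z_{j+1}=z_j+\phi(y_{j+1})$; if $z_j>0$, set $z_{j+1}=\varnothing$ and, if $j<n-2$, $z_{j+2}=z_j-\phi(x_{j+2})$; if $z_j=0$, set $z_k=0$ for all $j\le k\le n-1$. *)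

(* Defs.v *)
From HB Require Import structures.
From mathcomp Require Import all_boot all_order all_algebra.
From mathcomp Require Import classical_sets reals.

Set Implicit Arguments.
Unset Strict Implicit.
Unset Printing Implicit Defensive.

Import Order.TTheory GRing.Theory Num.Theory.
Local Open Scope ring_scope.

(** * The contracted zigzag graph on the vertices 1, ..., n *)

(* Vertices are natural numbers.  [inl k] is the slack edge x_(k+1), so that
   the slack edges are x_1, ..., x_(n-1); [inr k] is the nonslack edge y_k,
   so that the nonslack edges are y_0, ..., y_(n-1). *)
Definition edge (n : nat) : finType := ('I_n.-1 + 'I_n)%type.

Definition is_slack (n : nat) (e : edge n) : bool :=
  if e is inl _ then true else false.

(* [is_x i e]: e is the edge x_i (false for every e if there is no such edge;
   likewise for [is_y]). *)
Definition is_x (n i : nat) (e : edge n) : bool :=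
  if e is inl k then k.+1 == i else false.

Definition is_y (n i : nat) (e : edge n) : bool :=
  if e is inr k then k == i :> nat else false.

(* The maximum and the minimum only matter for y_0 = (1, 2) and
   y_(n-1) = (n-1, n); every other y_k is (k, k+2). *)
Definition src (n : nat) (e : edge n) : nat :=
  match e with inl k => k.+1 | inr k => maxn k 1 end.

Definition tgt (n : nat) (e : edge n) : nat :=
  match e with inl k => k.+2 | inr k => minn k.+2 n end.

Definition inner (n v : nat) : bool := (1 < v < n)%N.

(** * The length-reverse-length framing *)

(* y_(v-2) precedes x_(v-1) among the edges entering the inner vertex v. *)
Definition in_lt (n v : nat) (e e' : edge n) : bool :=
  [&& inner n v, tgt e == v, tgt e' == v, ~~ is_slack e & is_slack e'].

(* x_v precedes y_v among the edges leaving the inner vertex v. *)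
Definition out_lt (n v : nat) (e e' : edge n) : bool :=
  [&& inner n v, src e == v, src e' == v, is_slack e & ~~ is_slack e'].

(** * Routes, conflicts and maximal cliques *)

Fixpoint is_path (n u : nat) (p : seq (edge n)) (v : nat) : bool :=
  if p is e :: p' then (src e == u) && is_path (tgt e) p' v else u == v.

Definition prefix_lt (n : nat) (P P' : seq (edge n)) : Prop :=
  exists (A A' S : seq (edge n)) (e e' : edge n) (j : nat),
    [/\ P = A ++ e :: S, P' = A' ++ e' :: S & in_lt j e e'].

Definition suffix_lt (n : nat) (Q Q' : seq (edge n)) : Prop :=
  exists (S B B' : seq (edge n)) (e e' : edge n) (k : nat),
    [/\ Q = S ++ e :: B, Q' = S ++ e' :: B' & out_lt k e e'].

Definition conflict_at (n i : nat) (r r' : seq (edge n)) : Prop :=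
  exists P Q P' Q' : seq (edge n),
    [/\ r = P ++ Q /\ r' = P' ++ Q',
        is_path 1 P i /\ is_path i Q n,
        is_path 1 P' i /\ is_path i Q' n &
        (prefix_lt P P' /\ suffix_lt Q' Q) \/
        (prefix_lt P' P /\ suffix_lt Q Q')].

(* Every edge increases the vertex, so a directed path of the graph has fewer
   than n edges: bounding the length by n loses no path, and makes the type
   of paths finite. *)
Definition bpath (n : nat) : finType := n.-bseq (edge n).

Definition is_route (n : nat) (r : bpath n) : bool := is_path 1 r n.

Definition clique (n : nat) (C : {set bpath n}) : Prop :=
  (forall r, r \in C -> is_route r) /\
  (forall r r' i, r \in C -> r' \in C -> inner n i -> ~ conflict_at i r r').

Definition maximal_clique (n : nat) (C : {set bpath n}) : Prop :=
  clique C /\ (forall D : {set bpath n}, clique D -> C \subset D -> D = C).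

(** * The triangulation and its dual graph *)

Definition route_vec (R : realType) (n : nat) (r : bpath n) :
    {ffun edge n -> R} :=
  [ffun e => (e \in val r)%:R].

Definition route_hull (R : realType) (n : nat) (C : {set bpath n}) :
    set {ffun edge n -> R} :=
  [set v : {ffun edge n -> R} | exists w : bpath n -> R,
     [/\ forall r, r \in C -> 0 <= w r,
         \sum_(r in C) w r = 1 &
         forall e, v e = \sum_(r in C) w r * route_vec R r e]]%classic.
Arguments route_hull R {n} C _.

Definition LRL_simplices (R : realType) (n : nat) :
    set (set {ffun edge n -> R}) :=
  [set D | exists C, maximal_clique C /\ D = route_hull R C]%classic.

(* The routes of a maximal clique C are the vertices of the simplex
   [route_hull R C]; its codimension 1 faces are obtained by omitting one
   vertex. *)
Definition codim1_face (R : realType) (n : nat)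
    (F D : set {ffun edge n -> R}) : Prop :=
  exists C r, [/\ maximal_clique C, D = route_hull R C, r \in C &
                  F = route_hull R (C :\ r)%SET].

Definition dual_adjacent (R : realType) (n : nat)
    (D D' : set {ffun edge n -> R}) : Prop :=
  [/\ LRL_simplices D, LRL_simplices D', D <> D' &
      exists F, codim1_face F D /\ codim1_face F D'].

(** * Integer flows *)

Definition netflow (n v : nat) : int :=
  if v == 1%N then 0 else if v == n then - (n%:Z - 2) else 1.

Definition integer_flow (n : nat) (phi : {ffun edge n -> nat}) : Prop :=
  forall v : nat, (1 <= v <= n)%N ->
    (\sum_(e | tgt e == v) phi e)%N%:Z + netflow n v
    = (\sum_(e | src e == v) phi e)%N%:Z.

Definition clique_prefixes (n : nat) (C : {set bpath n}) (e : edge n) :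
    {set bpath n} :=
  [set P : bpath n | is_path 1 P (src e) &&
     [exists r in C, prefix (rcons P e) r]]%SET.

(* [phi] is the flow of the clique [C].  Stated with a successor rather than a
   predecessor so that no truncated subtraction is involved. *)
Definition flow_of_clique (n : nat) (C : {set bpath n})
    (phi : {ffun edge n -> nat}) : Prop :=
  forall e : edge n,
    if src e == 1%N then phi e = 0%N else (phi e).+1 = #|clique_prefixes C e|.

Definition corresponding (R : realType) (n : nat)
    (D : set {ffun edge n -> R}) (phi : {ffun edge n -> nat}) : Prop :=
  exists C, [/\ maximal_clique C, D = route_hull R C & flow_of_clique C phi].

(* The elementary move m_i^+, [None] when it is not defined.  Conditions and
   changes at nonexistent edges disappear, since no [e] satisfies the
   corresponding [is_x] or [is_y]. *)
Definition move (n i : nat) (phi : {ffun edge n -> nat}) :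
    option {ffun edge n -> nat} :=
  if [forall e, (is_x i e || is_y i.+1 e) ==> (0 < phi e)%N] then
    Some [ffun e => if is_x i e || is_y i.+1 e then (phi e).-1
                    else if is_x i.+2 e || is_y i e then (phi e).+1
                    else phi e]
  else None.

(** * Sequences of offsets *)

(* The values phi(x_j) and phi(y_j): each sum has one term if the edge exists,
   and none otherwise. *)
Definition flow_x (n : nat) (phi : {ffun edge n -> nat}) (j : nat) : int :=
  (\sum_(e | is_x j e) phi e)%N%:Z.

Definition flow_y (n : nat) (phi : {ffun edge n -> nat}) (j : nat) : int :=
  (\sum_(e | is_y j e) phi e)%N%:Z.

(* [offsets_from phi m j z] is (z_j, ..., z_(j+m)) when z_j = z and
   j + m = n - 1; [None] stands for the empty-set symbol. *)
Fixpoint offsets_from (n : nat) (phi : {ffun edge n -> nat}) (m j : nat)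
    (z : int) : seq (option int) :=
  if z == 0 then nseq m.+1 (Some 0) else
  match m with
  | 0 => [:: Some z]
  | m1.+1 =>
      if z < 0 then
        Some z :: offsets_from phi m1 j.+1 (z + flow_y phi j.+1)
      else
        match m1 with
        | 0 => [:: Some z; None]
        | m2.+1 =>
            [:: Some z, None
              & offsets_from phi m2 j.+2 (z - flow_x phi j.+2)]
        end
  end.

(* (z_(i+1), ..., z_(n-1)), which is empty for i = n - 1. *)
Definition offsets (n i : nat) (phi : {ffun edge n -> nat}) :
    seq (option int) :=
  if (n.-1 <= i)%N then [::]
  else offsets_from phi (n.-1 - i.+1) i.+1 (flow_y phi i.+1).

(* Main.v *)
(* A clique C with flow phi determines, at every inner vertex j, the list of its
   prefixes at j, sorted by the framing: since no two routes conflict, the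
   prefixes continued by x_j all lie weakly below those continued by y_j, and
   counting with the flow equation shows that the former are the first
   phi(x_j) + 1 and the latter the last phi(y_j) + 1 of the list, with exactly one
   prefix in common.  So C is computed from phi by the recursion
   prefixes (j + 2) = [last phi(y_j) + 1 prefixes at j] y_j
                      ++ [first phi(x_(j+1)) + 1 prefixes at j + 1] x_(j+1).
   Applying m_i^+ replaces the prefix at position phi(y_(i+1)) of the list at
   i + 3.  When lists differ at position c of vertex j only, c - phi(x_j) is the
   offset z_j: if it is positive the difference moves along y_j to vertex j + 2, if
   it is negative it moves along x_j to vertex j + 1, and if it is zero both
   extensions differ, so that at least two routes change.  Finally a simplex
   determines its set of routes because distinct 0/1 vectors are convexly
   independent. *)
Require Import Defs.
From mathcomp Require Import all_boot all_order all_algebra.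
From mathcomp Require Import boolp classical_sets reals.
From mathcomp Require Import zify.

Import Order.TTheory GRing.Theory Num.Theory.
Set Implicit Arguments.
Unset Strict Implicit.
Unset Printing Implicit Defensive.

(** * Edges and directed paths of the graph *)

Local Open Scope nat_scope.

(* x_j for 0 < j < n + 3 (with [xedge n 0] the same as x_1), and y_j for
   j < n + 3, in the graph on n + 3 vertices. *)
Definition xedge n j : edge n.+3 := inl (inord j.-1).
Definition yedge n j : edge n.+3 := inr (inord j).

Lemma src_xedge n j : 0 < j < n.+3 -> src (xedge n j) = j.
Proof. by move=> hj; rewrite /src /xedge inordK; lia. Qed.

Lemma tgt_xedge n j : 0 < j < n.+3 -> tgt (xedge n j) = j.+1.
Proof. by move=> hj; rewrite /tgt /xedge inordK; lia. Qed.

Lemma src_yedge n j : 0 < j < n.+3 -> src (yedge n j) = j.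
Proof. by move=> hj; rewrite /src /yedge inordK; lia. Qed.

Lemma tgt_yedge n j : j < n.+3 -> tgt (yedge n j) = minn j.+2 n.+3.
Proof. by move=> hj; rewrite /tgt /yedge inordK; lia. Qed.

Lemma xedgeP n j (e : edge n.+3) : 0 < j -> is_x j e -> e = xedge n j.
Proof.
case: e => [k|//] hj /= /eqP hk; have := ltn_ord k => /= ?.
by congr inl; apply: val_inj; rewrite /= inordK; lia.
Qed.

Lemma yedgeP n j (e : edge n.+3) : is_y j e -> e = yedge n j.
Proof.
case: e => [//|k] /= /eqP hk; have := ltn_ord k => /= ?.
by congr inr; apply: val_inj; rewrite /= inordK; lia.
Qed.

Lemma is_xE n j (e : edge n.+3) : 0 < j < n.+3 -> is_x j e = (e == xedge n j).
Proof.
move=> hj; apply/idP/eqP => [|->]; first by apply: xedgeP; lia.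
by rewrite /= inordK; lia.
Qed.

Lemma is_yE n j (e : edge n.+3) : j < n.+3 -> is_y j e = (e == yedge n j).
Proof.
move=> hj; apply/idP/eqP => [|->]; first by apply: yedgeP; lia.
by rewrite /= inordK; lia.
Qed.

Lemma src_eqE n j (e : edge n.+3) : 1 < j < n.+3 ->
  (src e == j) = (e == xedge n j) || (e == yedge n j).
Proof.
move=> hj; rewrite -is_xE -?is_yE; [|lia|lia].
case: e => k; have := ltn_ord k; rewrite /= ?orbF; lia.
Qed.

Lemma tgt_eqE n j (e : edge n.+3) : 1 < j < n.+3 ->
  (tgt e == j) = (e == xedge n j.-1) || (e == yedge n j.-2).
Proof.
move=> hj; rewrite -is_xE -?is_yE; [|lia|lia].
case: e => k; have := ltn_ord k; rewrite /= ?orbF; lia.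
Qed.

Lemma tgt_sinkE n (e : edge n.+3) : tgt e = n.+3 ->
  [\/ e = yedge n n.+1, e = xedge n n.+2 | e = yedge n n.+2].
Proof.
case: e => k; have := ltn_ord k; rewrite /= => hk he.
  by apply: Or32; apply: xedgeP => //=; lia.
have [h|h] : k = n.+1 :> nat \/ k = n.+2 :> nat by lia.
  by apply: Or31; apply: yedgeP => /=; lia.
by apply: Or33; apply: yedgeP => /=; lia.
Qed.

Lemma src_gt0 n (e : edge n.+3) : 0 < src e.
Proof. by case: e => k /=; lia. Qed.

Lemma src_lt_tgt n (e : edge n.+3) : src e < tgt e.
Proof. by case: e => k; have := ltn_ord k => /=; lia. Qed.

Lemma is_path_cat n u v (p q : seq (edge n)) :
  is_path u (p ++ q) v <-> exists2 w, is_path u p w & is_path w q v.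
Proof.
elim: p u => [|e p IH] u /=.
  by split=> [h|[w /eqP-> //]]; exists u.
split=> [/andP[h /IH [w hp hq]]|[w /andP[h hp] hq]].
  by exists w => //; rewrite h.
by rewrite h; apply/IH; exists w.
Qed.

Lemma is_path_rcons n u v (p : seq (edge n)) e :
  is_path u (rcons p e) v = is_path u p (src e) && (tgt e == v).
Proof.
elim: p u => [|f p IH] u /=; first by rewrite eq_sym.
by rewrite IH andbA.
Qed.

Lemma is_path_target n u v w (p : seq (edge n)) :
  is_path u p v -> is_path u p w -> v = w.
Proof.
elim: p u => [|e p IH] u /= => [/eqP <- /eqP //|].
by case/andP=> _ hv /andP[_]; apply: IH.
Qed.

Lemma is_path_drop n u v w (p q : seq (edge n)) :
  is_path u (p ++ q) w -> is_path u p v -> is_path v q w.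
Proof. by move=> /is_path_cat[v' hp hq] /(is_path_target hp) <-. Qed.

Lemma is_path_source_le n u v (p : seq (edge n.+3)) :
  is_path u p v -> u <= v.
Proof.
elim: p u => [|e p IH] u /= => [/eqP -> //|/andP[/eqP <- /IH]].
exact/leq_trans/ltnW/src_lt_tgt.
Qed.

Lemma is_path_loop n u (p : seq (edge n.+3)) : is_path u p u -> p = [::].
Proof.
case: p => // e p /= /andP[/eqP <- /is_path_source_le].
by rewrite leqNgt src_lt_tgt.
Qed.

Lemma path_sorted_src n u v (p : seq (edge n.+3)) :
  is_path u p v -> sorted (relpre (@src n.+3) ltn) p.
Proof.
case: p => // e p /= /andP[_].
elim: p e => //= f p IH e /andP[/eqP h /IH ->].
by rewrite h src_lt_tgt.
Qed.

(** Sources strictly increase along a path, so a path is the sorted enumeration of its edge set;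
    hence an indicator vector determines its route. *)
Lemma eq_mem_path n u v (p q : seq (edge n.+3)) :
  is_path u p v -> is_path u q v -> p =i q -> p = q.
Proof.
move=> /path_sorted_src hp /path_sorted_src hq.
apply: irr_sorted_eq hp hq => [y x z|x]; first exact: ltn_trans.
exact: ltnn.
Qed.

(** * Simplices and their sets of routes *)

Local Open Scope ring_scope.

Lemma route_hull_mem (R : realType) n (C : {set bpath n.+3}) (r : bpath n.+3) :
    (forall s, s \in C -> is_route s) -> is_route r ->
  route_hull R C (route_vec R r) <-> r \in C.
Proof.
move=> hC hr; split; last first.
  move=> rC; exists (fun s => (s == r)%:R); split=> [s _||e].
  - exact: ler0n.
  - rewrite (bigD1 r) //= eqxx big1 ?addr0 // => s /andP[_ /negPf ->].
    by [].
  - rewrite (bigD1 r) //= eqxx mul1r big1 ?addr0 // => s /andP[_ /negPf ->].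
    by rewrite mul0r.
case=> w [w0 w1 hw].
have [s sC ws] : exists2 s, s \in C & w s != 0.
  apply/exists_inP; apply: contraT => /exists_inPn h.
  move: w1; rewrite big1 => [/eqP|s /h /negPn/eqP //].
  by rewrite eq_sym oner_eq0.
suff -> : r = s by [].
apply: val_inj; apply: (eq_mem_path hr (hC _ sC)) => e.
(* If [e] lies on [r], the sum of w_t (1 - [e in t]) vanishes; otherwise the sum of w_t [e in t]
   does. All terms are nonnegative and [w s] is nonzero, so [s] agrees with [r] at [e]. *)
have := hw e; rewrite ffunE; case: (boolP (e \in val r)) => er.
  have -> : 1%:R = \sum_(t in C) w t by rewrite w1.
  move/eqP; rewrite -subr_eq0 -sumrB psumr_eq0 => [|t tC]; last first.
    by rewrite ffunE; case: (_ \in _); rewrite ?mulr1 ?subrr ?mulr0 ?subr0 // w0.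
  move/allP/(_ s (mem_index_enum _)); rewrite sC ffunE /=.
  by case: (_ \in _) => //; rewrite mulr0 subr0 (negPf ws).
move/esym/eqP; rewrite psumr_eq0 => [|t tC]; last first.
  by rewrite mulr_ge0 ?w0 // ffunE ler0n.
move/allP/(_ s (mem_index_enum _)); rewrite sC ffunE /=.
by case: (_ \in _) => //; rewrite mulr1 (negPf ws).
Qed.

Lemma route_hull_inj (R : realType) n (C C' : {set bpath n.+3}) :
    (forall s, s \in C -> is_route s) -> (forall s, s \in C' -> is_route s) ->
  route_hull R C = route_hull R C' -> C = C'.
Proof.
move=> hC hC' h; apply/setP => r; apply/idP/idP => rC.
  by apply/(route_hull_mem R hC' (hC _ rC)); rewrite -h; apply/route_hull_mem => //; apply: hC.
by apply/(route_hull_mem R hC (hC' _ rC)); rewrite h; apply/route_hull_mem => //; apply: hC'.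
Qed.

(** [route_hull_inj] applies to all sets of routes, so to the facets as well as to the simplices;
    adjacency thereby becomes a statement about finite sets. *)
Lemma dual_adjacentE (R : realType) n (C C' : {set bpath n.+3}) :
    maximal_clique C -> maximal_clique C' ->
  dual_adjacent (route_hull R C) (route_hull R C') <->
  C <> C' /\ exists r r', [/\ r \in C, r' \in C' & C :\ r = C' :\ r']%SET.
Proof.
move=> mC mC'.
have rt E : maximal_clique E -> forall s, s \in E -> is_route s by case=> -[].
have rtD (E : {set bpath n.+3}) t : maximal_clique E -> forall s, s \in (E :\ t)%SET -> is_route s.
  by move=> mE s /setD1P[_]; apply: rt.
split.
  case=> _ _ hD [F [[E [r [mE hE rE ->]]] [E' [r' [mE' hE' rE' hF]]]]].
  have ? : C = E by apply: route_hull_inj hE; apply: rt.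
  have ? : C' = E' by apply: route_hull_inj hE'; apply: rt.
  subst E E'; split=> [h|]; first by rewrite h in hD.
  by exists r, r'; split=> //; apply: route_hull_inj hF; apply: rtD.
case=> hne [r [r' [rC rC' h]]]; split; [by exists C|by exists C'| |].
  by move=> hD; apply: hne; apply: route_hull_inj hD; apply: rt.
exists (route_hull R (C :\ r)%SET); split; first by exists C, r.
by exists C', r'; rewrite -h.
Qed.

(** * Two non-crossing predicates along a list *)

Local Open Scope nat_scope.

Lemma count_eq0_all T (X : pred T) (s : seq T) :
  all (fun t => ~~ X t) s -> count X s = 0.
Proof. by rewrite all_predC has_count; lia. Qed.

(** After an element satisfying [Y] no later one satisfies [X], so at most one element is counted
    twice. *)
Lemma count_cross_le T (X Y : pred T) (s : seq T) :
  pairwise (fun t u => ~~ (Y t && X u)) s -> count X s + count Y s <= (size s).+1.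
Proof.
elim: s => //= t s IH /andP[ht /IH {}IH]; case: (boolP (Y t)) ht => Yt /= ht; last first.
  by case: (X t) => /=; lia.
by rewrite count_eq0_all //; have := count_size Y s; case: (X t) => /=; lia.
Qed.

(** This is the extreme case of [count_cross_le]: the two predicates cut out an initial and a final
    segment that share exactly position [a]. *)
Lemma filter_cross T (X Y : pred T) (s : seq T) a b :
    pairwise (fun t u => ~~ (Y t && X u)) s ->
    count X s = a.+1 -> count Y s = b.+1 -> size s = (a + b).+1 ->
  filter X s = take a.+1 s /\ filter Y s = drop a s.
Proof.
elim: s a => //= t s IH a /andP[ht hs].
case: (boolP (Y t)) ht => Yt /= ht hX hY hsz.
  move: hX; rewrite count_eq0_all //; case: (boolP (X t)) => //= Xt [] ha; subst a.
  have hXs : filter X s = [::] by apply: size0nil; rewrite size_filter count_eq0_all.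
  rewrite hXs take0; split=> //; congr cons; apply/all_filterP; rewrite all_count; apply/eqP; lia.
(* Were [X t] false as well, the tail would violate this bound. *)
have hle := count_cross_le hs.
case: (boolP (X t)) hX => Xt /= hX; last by lia.
have ha : 0 < a by have := count_size Y s; lia.
by case: a ha hX hsz => // a _ hX hsz; have [||||-> ->] := IH a; lia || split.
Qed.

Lemma uniq_filter_mem (T : eqType) (X : pred T) (s s' : seq T) :
  uniq s -> filter X s = s' -> (forall t, X t -> t \in s) -> s' =i X.
Proof.
by move=> us <- h t; rewrite mem_filter; apply/andP/idP => [[]|Xt] //; split=> //; apply: h.
Qed.

(** * Prefixes occurring in a clique *)

Definition cprefix n (C : {set bpath n}) j (P : seq (edge n)) :=
  is_path 1 P j && [exists r in C, prefix P (val r)].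

(** Membership in [clique_prefixes], but on plain sequences, so that it can filter lists of
    prefixes; [size_cext] makes the link. *)
Definition cext n (C : {set bpath n}) (e : edge n) (P : seq (edge n)) :=
  is_path 1 P (src e) && [exists r in C, prefix (rcons P e) (val r)].

Lemma cprefix_rcons n (C : {set bpath n}) j P e :
  cprefix C j (rcons P e) = cext C e P && (tgt e == j).
Proof. by rewrite /cprefix /cext is_path_rcons -!andbA; congr andb; rewrite andbC. Qed.

Lemma cextP n (C : {set bpath n}) (e : edge n) (P : seq (edge n)) :
  reflect (is_path 1 P (src e) /\ exists2 r, r \in C & exists Q, val r = P ++ e :: Q) (cext C e P).
Proof.
apply: (iffP andP) => -[hP].
  case/exists_inP=> r rC /prefixP[Q hQ]; split=> //.
  by exists r => //; exists Q; rewrite hQ cat_rcons.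
case=> r rC [Q hQ]; split=> //; apply/exists_inP; exists r => //.
by apply/prefixP; exists Q; rewrite cat_rcons.
Qed.

Lemma cext_cprefix n (C : {set bpath n}) (e : edge n) (P : seq (edge n)) :
  cext C e P -> cprefix C (src e) P.
Proof.
case/cextP=> hP [r rC [Q hQ]]; rewrite /cprefix hP; apply/exists_inP.
by exists r => //; apply/prefixP; exists (e :: Q).
Qed.

Lemma size_cext n (C : {set bpath n}) (e : edge n) (s : seq (seq (edge n))) :
  uniq s -> s =i cext C e -> size s = #|clique_prefixes C e|.
Proof.
move=> us hs; rewrite cardE -(size_map val); apply/perm_size/uniq_perm => //.
  by rewrite map_inj_uniq ?enum_uniq //; apply: val_inj.
move=> P; rewrite hs unfold_in; apply/idP/mapP => [hP|[p]].
  have szP : size P <= n.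
    case/cextP: (hP) => _ [r _ [Q hQ]].
    have := size_bseq r; rewrite hQ size_cat; exact/leq_trans/leq_addr.
  by exists (Bseq szP) => //; rewrite mem_enum inE.
by rewrite mem_enum inE => hp ->.
Qed.

Lemma prefix_lt_rcons n (P P' : seq (edge n)) e :
  prefix_lt P P' -> prefix_lt (rcons P e) (rcons P' e).
Proof.
case=> A [A' [S [f [f' [j [-> -> h]]]]]].
by exists A, A', (rcons S e), f, f', j; rewrite !rcons_cat.
Qed.

(** As x_j precedes y_j among the edges leaving j, a lower prefix continued by y_j and a higher one
    continued by x_j would conflict at j. *)
Lemma clique_cross n (C : {set bpath n.+3}) j P P' :
    clique C -> 1 < j < n.+3 -> prefix_lt P P' ->
  ~~ (cext C (yedge n j) P && cext C (xedge n j) P').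
Proof.
move=> [rC ncC] hj hlt; apply/negP => /andP[].
have sx : src (xedge n j) = j by apply: src_xedge; lia.
have sy : src (yedge n j) = j by apply: src_yedge; lia.
case/cextP; rewrite sy => hP [r rinC [Q hr]].
case/cextP; rewrite sx => hP' [r' r'inC [Q' hr']].
apply: (ncC r r' j) => //; exists P, (yedge n j :: Q), P', (xedge n j :: Q').
split=> //; try split=> //.
- by apply: is_path_drop hP; rewrite -hr; apply: rC.
- by apply: is_path_drop hP'; rewrite -hr'; apply: rC.
left; split=> //; exists [::], Q', Q, (xedge n j), (yedge n j), j.
by split=> //; rewrite /out_lt sx sy eqxx /inner hj.
Qed.

(** * Flows and the lists of prefixes they determine *)

Definition flow_equations n (phi : {ffun edge n.+3 -> nat}) :=
  [/\ phi (xedge n 1) = 0, phi (yedge n 0) = 0, phi (yedge n 1) = 0 &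
      forall k, k <= n -> phi (xedge n k.+2) + phi (yedge n k.+2) =
                          (phi (yedge n k) + phi (xedge n k.+1)).+1].

Lemma integer_flow_equations n (phi : {ffun edge n.+3 -> nat}) :
  integer_flow phi -> flow_equations phi.
Proof.
move=> hphi.
(* No edge enters vertex 1, whose net flow is 0, so every edge leaving it carries 0. *)
have h1 e : src e = 1 -> phi e = 0.
  move=> he; have := hphi 1 isT; rewrite big_pred0 /netflow => [|f]; last first.
    by apply/eqP => hf; have := src_lt_tgt f; rewrite hf; have := src_gt0 f; lia.
  rewrite eqxx (bigD1 e) /= ?he //; lia.
split; try by apply: h1; rewrite ?src_xedge ?src_yedge.
  by apply: h1; rewrite /= inordK.
move=> k hk; have hk2 : 1 <= k.+2 <= n.+3 by lia.
have := hphi _ hk2; rewrite /netflow (_ : (k.+2 == n.+3) = false) /=; last by lia.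
have sum2 (l : 'I_n.+2) (m : 'I_n.+3) (p : pred (edge n.+3)) :
    p =1 (fun e => (e == inl l) || (e == inr m)) ->
    \sum_(e | p e) phi e = phi (inl l) + phi (inr m).
  move=> hp; rewrite (bigD1 (inl l)) ?hp ?eqxx //= (big_pred1 (inr m)) // => e /=.
  by rewrite hp; case: e => e; rewrite ?andbN ?andbT ?orbF //= andbN.
rewrite (sum2 (inord k) (inord k)) => [|e]; last by rewrite tgt_eqE //; lia.
rewrite (sum2 (inord k.+1) (inord k.+2)) => [|e]; last by rewrite src_eqE //; lia.
rewrite /xedge /yedge /=; lia.
Qed.

(* The fictitious list at vertex 0, with a single empty prefix, lets y_0 be treated
   like the other edges y_j. *)
Fixpoint prefixes n (phi : {ffun edge n.+3 -> nat}) j : seq (seq (edge n.+3)) :=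
  match j with
  | 0 => [:: [::]]
  | j1.+1 => match j1 with
    | 0 => [:: [::]]
    | k.+1 =>
        [seq rcons P (yedge n k) | P <- drop (phi (xedge n k)) (prefixes phi k)] ++
        [seq rcons P (xedge n j1) | P <- take (phi (xedge n j1)).+1 (prefixes phi j1)]
    end
  end.

(** Three edges enter the sink n+3: the recursion of [prefixes] covers y_(n+1) and x_(n+2), and
    y_(n+2) is added here. *)
Definition routes n (phi : {ffun edge n.+3 -> nat}) :=
  prefixes phi n.+3 ++
  [seq rcons P (yedge n n.+2) | P <- drop (phi (xedge n n.+2)) (prefixes phi n.+2)].

Lemma prefixesSS n (phi : {ffun edge n.+3 -> nat}) k :
  prefixes phi k.+2 =
    [seq rcons P (yedge n k) | P <- drop (phi (xedge n k)) (prefixes phi k)] ++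
    [seq rcons P (xedge n k.+1) | P <- take (phi (xedge n k.+1)).+1 (prefixes phi k.+1)].
Proof. by []. Qed.

(** By induction with conservation at k+2. Consequently dropping phi(x_j) entries keeps exactly the
    last phi(y_j) + 1. *)
Lemma size_prefixes n (phi : {ffun edge n.+3 -> nat}) j :
    flow_equations phi -> j <= n.+2 ->
  size (prefixes phi j) = (phi (xedge n j) + phi (yedge n j)).+1.
Proof.
(* [xedge n 0] coincides with x_1, so the fictitious vertex 0 obeys the formula too. *)
case=> x1 y0 y1 hf; have x0 : phi (xedge n 0) = 0 by [].
elim/ltn_ind: j => -[|[|k]] IH hk; rewrite ?x0 ?x1 ?y0 ?y1 //.
have [h0 h1] := (IH k (ltnW (ltnSn _)) ltac:(lia), IH k.+1 (ltnSn _) ltac:(lia)).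
rewrite prefixesSS size_cat !size_map size_drop size_take_min h0 h1.
by have := hf k; lia.
Qed.

Lemma yedge_eq n j k :
  j < n.+3 -> k < n.+3 -> (yedge n j == yedge n k) = (j == k).
Proof. by move=> hj hk; rewrite -is_yE //= inordK. Qed.

Lemma mem_map_rcons (T : eqType) (e : T) (s : seq (seq T)) P f :
  (rcons P f \in [seq rcons Q e | Q <- s]) = (f == e) && (P \in s).
Proof.
apply/mapP/andP => [[Q Qs /rcons_inj[-> ->]]|[/eqP -> Ps]]; first by rewrite eqxx.
by exists P.
Qed.

Lemma uniq_cat_map_rcons (T : eqType) (e f : T) (s t : seq (seq T)) :
  e != f -> uniq s -> uniq t ->
  uniq ([seq rcons P e | P <- s] ++ [seq rcons P f | P <- t]).
Proof.
move=> hef us ut; rewrite cat_uniq !map_inj_uniq ?us ?ut ?andbT /=;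
  try by move=> P Q /rcons_inj[].
by apply/hasPn => _ /mapP[P _ ->]; rewrite mem_map_rcons eq_sym (negPf hef).
Qed.

Lemma uniq_prefixes n (phi : {ffun edge n.+3 -> nat}) j : uniq (prefixes phi j).
Proof.
elim/ltn_ind: j => -[|[|k]] IH //; rewrite prefixesSS.
by apply: uniq_cat_map_rcons; rewrite ?drop_uniq ?take_uniq ?IH.
Qed.

Lemma uniq_routes n (phi : {ffun edge n.+3 -> nat}) : uniq (routes phi).
Proof.
rewrite /routes cat_uniq uniq_prefixes map_inj_uniq ?drop_uniq ?uniq_prefixes //;
  last by move=> P Q /rcons_inj[].
rewrite andbT; apply/hasPn => _ /mapP[P _ ->].
rewrite prefixesSS mem_cat !mem_map_rcons /= orbF.
suff -> : (yedge n n.+2 == yedge n n.+1) = false by [].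
by rewrite yedge_eq; lia.
Qed.

(** On entering k+2, y_k precedes x_(k+1), which orders the two blocks; inside a block, appending a
    common edge preserves the order. *)
Lemma pairwise_prefixes n (phi : {ffun edge n.+3 -> nat}) j :
  j < n.+3 -> pairwise (fun P P' => `[< prefix_lt P P' >]) (prefixes phi j).
Proof.
elim/ltn_ind: j => -[|[|k]] IH // hk; rewrite prefixesSS pairwise_cat.
have mono e (s : seq (seq (edge n.+3))) :
    pairwise (fun P P' => `[< prefix_lt P P' >]) s ->
    pairwise (fun P P' => `[< prefix_lt P P' >]) [seq rcons P e | P <- s].
  rewrite pairwise_map; apply: sub_pairwise => P P' /asboolP h.
  exact/asboolP/prefix_lt_rcons.
apply/and3P; split.
- apply/allrelP => _ _ /mapP[P _ ->] /mapP[P' _ ->]; apply/asboolP.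
  exists P, P', [::], (yedge n k), (xedge n k.+1), k.+2; rewrite -!cats1; split=> //.
  rewrite /in_lt /inner tgt_xedge ?tgt_yedge //=; lia.
- by apply/mono/(subseq_pairwise (drop_subseq _ _))/IH; lia.
by apply/mono/(subseq_pairwise (take_subseq _ _))/IH; lia.
Qed.

(** * Maximal cliques recovered from their flows *)

Lemma cext_prefixes n (C : {set bpath n.+3}) phi j :
    flow_equations phi -> clique C -> flow_of_clique C phi -> 1 < j < n.+3 ->
    (forall P, cprefix C j P -> P \in prefixes phi j) ->
  (forall P, (P \in take (phi (xedge n j)).+1 (prefixes phi j)) = cext C (xedge n j) P) /\
  (forall P, (P \in drop (phi (xedge n j)) (prefixes phi j)) = cext C (yedge n j) P).
Proof.
move=> hphi hC hflow hj hsub.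
have sx : src (xedge n j) = j by apply: src_xedge; lia.
have sy : src (yedge n j) = j by apply: src_yedge; lia.
have subE e : src e = j -> forall P, cext C e P -> P \in prefixes phi j.
  by move=> se P /cext_cprefix; rewrite se; apply: hsub.
have cntE e : src e = j -> count (cext C e) (prefixes phi j) = (phi e).+1.
  move=> se; rewrite -size_filter (size_cext (C := C) (e := e)).
  - by have := hflow e; rewrite se; case: eqP => // hj1; lia.
  - exact/filter_uniq/uniq_prefixes.
  - exact: uniq_filter_mem (uniq_prefixes _ _) erefl (subE _ se).
(* The list is sorted and contains every prefix of [C] at j, so the two predicates do not cross; the
   flow makes their counts sum to one more than its length, which forces them to be its two
   segments. *)
have [|||| hx hy] := @filter_cross _ (cext C (xedge n j)) (cext C (yedge n j))
  (prefixes phi j) (phi (xedge n j)) (phi (yedge n j)).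
- have := @pairwise_prefixes n phi j; case/andP: (hj) => _ -> /(_ isT).
  by apply: sub_pairwise => P P' /asboolP; apply: clique_cross.
- exact: cntE.
- exact: cntE.
- by apply: size_prefixes => //; lia.
by split; [apply: uniq_filter_mem hx _|apply: uniq_filter_mem hy _];
  rewrite ?uniq_prefixes //; apply: subE.
Qed.

(** Strong induction through the last edge: it leaves an earlier vertex, where [cext_prefixes]
    identifies the extendable prefixes. Edges leaving vertex 1 are treated apart, their only prefix
    being empty. *)
Lemma cprefix_prefixes n (C : {set bpath n.+3}) phi j P :
    flow_equations phi -> clique C -> flow_of_clique C phi -> 0 < j < n.+3 ->
  cprefix C j P -> P \in prefixes phi j.
Proof.
move=> hphi hC hflow; elim/ltn_ind: j P => -[//|[|k]] IH P hj.
  by case/andP => /is_path_loop -> _; rewrite inE.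
case: (lastP P) => [|{}P e]; first by [].
rewrite cprefix_rcons => /andP[hext]; rewrite tgt_eqE // -[k.+2.-1]/k.+1 -[k.+2.-2]/k => he.
rewrite prefixesSS mem_cat !mem_map_rcons.
have [j1|j1] := leqP k.+1 1.
  have {j1} k0 : k = 0 by lia.
  subst k; have se : src e = 1 by case/orP: he => /eqP ->; rewrite /= inordK.
  case/cextP: hext; rewrite se => /is_path_loop -> _; case: hphi => x1 _ _ _.
  by rewrite x1 /= !inE eqxx !andbT orbC.
case/orP: he => /eqP ?; subst e; rewrite eqxx.
  have [hx _] := @cext_prefixes n C phi k.+1 hphi hC hflow ltac:(lia)
    (fun Q => IH k.+1 (ltnSn _) Q ltac:(lia)).
  by rewrite hx hext orbT.
case: (ltnP 1 k) => k1.
  have [_ hy] := @cext_prefixes n C phi k hphi hC hflow ltac:(lia)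
    (fun Q => IH k (ltnW (ltnSn _)) Q ltac:(lia)).
  by rewrite hy hext.
have {}k1 : k = 1 by lia.
subst k; case/cextP: hext; rewrite src_yedge // => /is_path_loop -> _.
by case: hphi => x1 _ _ _; rewrite x1.
Qed.

Lemma mem_take_prefixes n (C : {set bpath n.+3}) phi j P :
    flow_equations phi -> clique C -> flow_of_clique C phi -> 1 < j < n.+3 ->
  (P \in take (phi (xedge n j)).+1 (prefixes phi j)) = cext C (xedge n j) P.
Proof.
move=> hphi hC hflow hj.
have [|hx _] := cext_prefixes hphi hC hflow hj; last exact: hx.
by move=> Q; apply: cprefix_prefixes => //; lia.
Qed.

Lemma mem_drop_prefixes n (C : {set bpath n.+3}) phi j P :
    flow_equations phi -> clique C -> flow_of_clique C phi -> 1 < j < n.+3 ->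
  (P \in drop (phi (xedge n j)) (prefixes phi j)) = cext C (yedge n j) P.
Proof.
move=> hphi hC hflow hj.
have [|_ hy] := cext_prefixes hphi hC hflow hj; last exact: hy.
by move=> Q; apply: cprefix_prefixes => //; lia.
Qed.

(* On three vertices the edge y_1 is a route that meets no inner vertex, so the
   flow gives no information on it and maximality is needed. *)
Lemma cext_yedge1 (C : {set bpath 3}) P :
  maximal_clique C -> cext C (yedge 0 1) P = (P == [::]).
Proof.
case=> -[rC ncC] maxC; apply/idP/eqP => [/cextP[]|->].
  by rewrite src_yedge // => /is_path_loop.
have sz : size [:: yedge 0 1] <= 3 by [].
pose r : bpath 3 := Bseq sz.
have pr : is_route r by rewrite /is_route /= inordK.
suff rinC : r \in C.
  apply/cextP; split; first by rewrite src_yedge.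
  by exists r => //; exists [::].
have no_inner i (Q Q' : seq (edge 3)) : inner 3 i -> val r = Q ++ Q' -> ~ is_path 1 Q i.
  case: Q => [|e [|f Q]] //=; first by rewrite /inner; case: eqP => // <-.
  by rewrite /inner => hi [<- _]; rewrite tgt_yedge // => /andP[_ /eqP]; lia.
(* The route y_1 = (1,3) meets no inner vertex, so adding it to [C] creates no conflict. *)
rewrite -(maxC (r |: C)%SET) ?setU11 ?finset.subsetUr //.
split=> [s /setU1P[->//|]|s s' i]; first exact: rC.
move=> /setU1P[->|sC] /setU1P[->|s'C] hi.
- by case=> [P1 [Q [P1' [Q' [[h _] [h1 _] _ _]]]]]; apply: no_inner h h1.
- by case=> [P1 [Q [P1' [Q' [[h _] [h1 _] _ _]]]]]; apply: no_inner h h1.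
- by case=> [P1 [Q [P1' [Q' [[_ h] _ [h1 _] _]]]]]; apply: no_inner h h1.
exact: ncC.
Qed.

(** A route is a prefix at the sink, so its last edge reduces the claim to the extensions by
    y_(n+1), x_(n+2) and y_(n+2). *)
Lemma perm_routes n (C : {set bpath n.+3}) phi :
    flow_equations phi -> maximal_clique C -> flow_of_clique C phi ->
  perm_eq [seq val r | r <- enum C] (routes phi).
Proof.
move=> hphi mC hflow; have hC : clique C by case: mC.
apply: uniq_perm; rewrite ?uniq_routes ?map_inj_uniq ?enum_uniq //; first exact: val_inj.
move=> P.
have -> : (P \in [seq val r | r <- enum C]) = cprefix C n.+3 P.
  apply/mapP/andP => [[r]|[hP /exists_inP[r rC /prefixP[Q hQ]]]].
    rewrite mem_enum => rC ->; split; first by case: hC => + _; apply.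
    by apply/exists_inP; exists r; rewrite ?prefix_refl.
  exists r; rewrite ?mem_enum // hQ.
  suff -> : Q = [::] by rewrite cats0.
  apply: (@is_path_loop n n.+3); apply: is_path_drop hP; rewrite -hQ.
  by case: hC => + _; apply.
case: (lastP P) => [|{}P e].
  have nilN f s : ([::] \in [seq rcons Q f | Q <- s]) = false :> bool.
    by apply/mapP => -[[]].
  by rewrite /routes prefixesSS !mem_cat !nilN.
rewrite cprefix_rcons /routes prefixesSS !mem_cat !mem_map_rcons.
rewrite (mem_take_prefixes _ hphi hC hflow); last by lia.
rewrite ?(mem_drop_prefixes _ (j := n.+2) hphi hC hflow) //; try lia.
have -> : (P \in drop (phi (xedge n n.+1)) (prefixes phi n.+1)) = cext C (yedge n n.+1) P.
  (* y_(n+1) leaves an inner vertex except on three vertices, where it is y_1. *)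
  case: n C phi hphi mC hflow hC P e => [|n] C phi hphi mC hflow hC P e.
    by rewrite cext_yedge1 //; case: hphi => x1 _ _ _; rewrite x1 /= inE.
  by rewrite (mem_drop_prefixes _ hphi hC hflow) //; lia.
apply/andP/idP => [[hext /eqP/tgt_sinkE[] he]|]; first by subst e; rewrite hext eqxx.
- by subst e; rewrite hext eqxx orbT.
- by subst e; rewrite hext eqxx orbT.
case/orP => [/orP[]|] /andP[/eqP -> ->]; split=> //.
- by rewrite tgt_yedge //; lia.
- by rewrite tgt_xedge //; lia.
by rewrite tgt_yedge //; lia.
Qed.

(** * The elementary move on flows *)

Lemma flow_xE n (phi : {ffun edge n.+3 -> nat}) j :
  0 < j < n.+3 -> flow_x phi j = (phi (xedge n j))%:Z.
Proof.
move=> hj; rewrite /flow_x (big_pred1 (xedge n j)) // => e; exact: is_xE.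
Qed.

Lemma flow_yE n (phi : {ffun edge n.+3 -> nat}) j :
  j < n.+3 -> flow_y phi j = (phi (yedge n j))%:Z.
Proof.
move=> hj; rewrite /flow_y (big_pred1 (yedge n j)) // => e; exact: is_yE.
Qed.

Lemma moveE n (phi phi' : {ffun edge n.+3 -> nat}) i :
    1 < i < n.+3 -> move i phi = Some phi' ->
  [/\ 0 < phi (xedge n i), i.+1 < n.+3 -> 0 < phi (yedge n i.+1),
      forall j, 0 < j < n.+3 -> phi' (xedge n j) =
        if j == i then (phi (xedge n j)).-1
        else if j == i.+2 then (phi (xedge n j)).+1 else phi (xedge n j) &
      forall j, j < n.+3 -> phi' (yedge n j) =
        if j == i.+1 then (phi (yedge n j)).-1
        else if j == i then (phi (yedge n j)).+1 else phi (yedge n j)].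
Proof.
rewrite /move => hi; case: forallP => // hpos [<-]; split=> [|hi1|j hj|j hj].
- by apply: (implyP (hpos _)); rewrite is_xE ?eqxx //; lia.
- by apply: (implyP (hpos _)); rewrite is_yE ?eqxx ?orbT.
- by rewrite ffunE /= !orbF inordK; [rewrite prednK //; lia|lia].
by rewrite ffunE /= inordK.
Qed.

Lemma move_flow_equations n (phi phi' : {ffun edge n.+3 -> nat}) i :
    1 < i < n.+3 -> move i phi = Some phi' -> flow_equations phi ->
  flow_equations phi'.
Proof.
move=> hi /(moveE hi)[xpos ypos hx hy] [x1 y0 y1 hf]; split.
- by rewrite hx //; case: eqP => ?; rewrite ?x1 //; case: eqP; lia.
- by rewrite hy //; case: eqP => ?; rewrite ?y0 //; case: eqP; lia.
- by rewrite hy //; case: eqP => ?; rewrite ?y1 //; case: eqP; lia.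
move=> k hk; have := hf k hk; rewrite !hx ?hy; try lia.
(* Only the vertices i, i+1, i+2 and i+3 meet an altered edge; at each of them the two changes
   balance. *)
case: (eqVneq k.+2 i) => [?|]; first by subst i; do !case: eqP; lia.
case: (eqVneq k.+1 i) => [?|]; first by subst i; have := ypos ltac:(lia); do !case: eqP; lia.
case: (eqVneq k i) => [?|]; first by subst i; do !case: eqP; lia.
case: (eqVneq k i.+1) => [?|]; first by subst k; have := ypos ltac:(lia); do !case: eqP; lia.
by do !case: eqP; lia.
Qed.

(** * Exchanging one route or losing two *)

Definition exchanged (T : eqType) (s s' : seq T) :=
  exists p q B, [/\ perm_eq s (p :: B), perm_eq s' (q :: B) & p != q].

Lemma exchanged_at (T : eqType) (A B A' B' : seq T) p q :
  perm_eq (A ++ B) (A' ++ B') -> p != q -> exchanged (A ++ p :: B) (A' ++ q :: B').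
Proof.
move=> hp hpq; exists p, q, (A' ++ B'); split=> //.
  by rewrite -cat1s perm_catCA /= perm_cons.
by rewrite -cat1s perm_catCA.
Qed.

(** [P] sits at the one position shared by both segments, so it continues along both x_j and y_j;
    losing it costs at least two routes. *)
Definition branching n (phi phi' : {ffun edge n.+3 -> nat}) :=
  exists j P, [/\ 1 < j < n.+3, P \in take (phi (xedge n j)).+1 (prefixes phi j),
    P \in drop (phi (xedge n j)) (prefixes phi j) & P \notin prefixes phi' j].

Lemma exchanged_adjacent n (C C' : {set bpath n.+3}) phi phi' :
    flow_equations phi -> maximal_clique C -> flow_of_clique C phi ->
    flow_equations phi' -> maximal_clique C' -> flow_of_clique C' phi' ->
    exchanged (routes phi) (routes phi') ->
  C <> C' /\ exists r r', [/\ r \in C, r' \in C' & C :\ r = C' :\ r']%SET.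
Proof.
move=> hphi mC hC hphi' mC' hC' [p [q [B [pp pq hpq]]]].
have listC (E : {set bpath n.+3}) psi b :
    flow_equations psi -> maximal_clique E -> flow_of_clique E psi ->
    perm_eq (routes psi) (b :: B) ->
  [/\ b \notin B, forall s, (s \in E) = (val s \in b :: B) & exists2 r, r \in E & val r = b].
  move=> hpsi mE hE pE; have pV := perm_trans (perm_routes hpsi mE hE) pE.
  have memE s : (s \in E) = (val s \in b :: B).
    by rewrite -(perm_mem pV) mem_map ?mem_enum //; apply: val_inj.
  have bB : b \notin B by have := perm_uniq pE; rewrite uniq_routes /= => /esym/andP[].
  have : b \in [seq val r | r <- enum E] by rewrite (perm_mem pV) inE eqxx.
  by case/mapP => r; rewrite mem_enum => rE hb; split=> //; exists r.
have [pB memC [r rC hr]] := listC _ _ _ hphi mC hC pp.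
have [qB memC' [r' rC' hr']] := listC _ _ _ hphi' mC' hC' pq.
split=> [h|].
  by move: rC; rewrite h memC' hr inE (negPf hpq) (negPf pB).
exists r, r'; split=> //; apply/setP => s; rewrite !in_setD1 memC memC' !inE -hr -hr'.
rewrite !(inj_eq val_inj); case: (eqVneq s r) => [->|_] /=.
  by rewrite hr (negPf pB) orbF andNb.
by case: (eqVneq s r') => [->|_] //=; rewrite hr' (negPf qB).
Qed.

(** Two routes of [C] share the lost prefix and part at j. Neither is in [C'], so deleting a single
    route from [C] cannot remove both. *)
Lemma branching_not_adjacent n (C C' : {set bpath n.+3}) phi phi' :
    flow_equations phi -> maximal_clique C -> flow_of_clique C phi ->
    flow_equations phi' -> maximal_clique C' -> flow_of_clique C' phi' ->
    branching phi phi' ->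
  forall r r', (C :\ r)%SET <> (C' :\ r')%SET.
Proof.
move=> hphi [clC _] hC hphi' [clC' _] hC' [j [P [hj]]].
rewrite (mem_take_prefixes _ hphi clC hC) // (mem_drop_prefixes _ hphi clC hC) //.
move=> /cextP[]; rewrite src_xedge; last by lia.
move=> hP [rx rxC [Qx hQx]] /cextP[_ [ry ryC [Qy hQy]]] hN.
have notC' s Q : val s = P ++ Q -> s \notin C'.
  move=> hs; apply: contra hN => sC'; apply: (cprefix_prefixes hphi' clC' hC'); first by lia.
  rewrite /cprefix hP; apply/exists_inP; exists s => //; apply/prefixP; by exists Q.
move=> r r' hrr.
have eqr s Q : s \in C -> val s = P ++ Q -> s = r.
  move=> sC hs; apply/eqP; apply: contraT => hsr.
  have : s \in (C :\ r)%SET by rewrite in_setD1 hsr.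
  by rewrite hrr in_setD1 (negPf (notC' _ _ hs)) andbF.
have : P ++ xedge n j :: Qx = P ++ yedge n j :: Qy.
  by rewrite -hQx -hQy (eqr _ _ rxC hQx) (eqr _ _ ryC hQy).
by move/eqP; rewrite eqseq_cat // eqxx /= => /eqP.
Qed.

(** * Propagation of a single difference *)

(* The lists of prefixes differ only at position c of vertex k + 1; the equation
   says that nothing changes along the edge y_k, which jumps over k + 1. *)
Definition differ_at n (phi phi' : {ffun edge n.+3 -> nat}) k c :=
  drop (phi (xedge n k)) (prefixes phi k) = drop (phi' (xedge n k)) (prefixes phi' k) /\
  exists A p q B, [/\ prefixes phi k.+1 = A ++ p :: B, prefixes phi' k.+1 = A ++ q :: B,
    size A = c & p != q].

Lemma differ_at_routes n (phi phi' : {ffun edge n.+3 -> nat}) c :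
  differ_at phi phi' n.+2 c -> exchanged (routes phi) (routes phi').
Proof.
case=> hd [A [p [q [B [hp hq _ hpq]]]]].
by rewrite /routes hp hq hd -!catA !cat_cons; apply: exchanged_at.
Qed.

(** Position c lies beyond the first phi(x_(k+1)) + 1 entries, so x_(k+1) does not transmit the
    difference. *)
Lemma differ_at_prefixes_eq n (phi phi' : {ffun edge n.+3 -> nat}) k c :
    phi' (xedge n k.+1) = phi (xedge n k.+1) -> phi (xedge n k.+1) < c ->
    differ_at phi phi' k c ->
  prefixes phi k.+2 = prefixes phi' k.+2.
Proof.
move=> hx hc [hd [A [p [q [B [hp hq hA hpq]]]]]].
by rewrite !prefixesSS hd hp hq hx !takel_cat ?hA.
Qed.

(** The difference jumps along y_(k+1) to k+3, where that block comes first; the position falls by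
    the number of dropped entries. *)
Lemma differ_at_nonslack n (phi phi' : {ffun edge n.+3 -> nat}) k c :
    phi' (xedge n k.+1) = phi (xedge n k.+1) -> phi' (xedge n k.+2) = phi (xedge n k.+2) ->
    phi (xedge n k.+1) < c -> differ_at phi phi' k c ->
  differ_at phi phi' k.+2 (c - phi (xedge n k.+1)).
Proof.
move=> hx hx2 hc hdiff; have hP := differ_at_prefixes_eq hx hc hdiff.
case: hdiff => hd [A [p [q [B [hp hq hA hpq]]]]].
split; first by rewrite hx2 hP.
exists [seq rcons P (yedge n k.+1) | P <- drop (phi (xedge n k.+1)) A].
exists (rcons p (yedge n k.+1)), (rcons q (yedge n k.+1)).
exists ([seq rcons P (yedge n k.+1) | P <- B] ++
  [seq rcons P (xedge n k.+2) | P <- take (phi (xedge n k.+2)).+1 (prefixes phi k.+2)]).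
split.
- by rewrite prefixesSS hp drop_cat hA hc map_cat /= -catA cat_cons.
- by rewrite prefixesSS -hP hx hx2 hq drop_cat hA hc map_cat /= -catA cat_cons.
- by rewrite size_map size_drop hA.
by apply: contra hpq => /eqP/rcons_inj[->].
Qed.

(** The difference lies in the segment continued by x_(k+1) only; at k+2 it is shifted by the block
    of y_k, which comes first. *)
Lemma differ_at_slack n (phi phi' : {ffun edge n.+3 -> nat}) k c :
    phi' (xedge n k.+1) = phi (xedge n k.+1) ->
    c < phi (xedge n k.+1) -> differ_at phi phi' k c ->
  differ_at phi phi' k.+1 (size (drop (phi (xedge n k)) (prefixes phi k)) + c).
Proof.
move=> hx hc [hd [A [p [q [B [hp hq hA hpq]]]]]].
have takeE r : take (phi (xedge n k.+1)).+1 (A ++ r :: B) =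
    A ++ r :: take (phi (xedge n k.+1) - c) B.
  by rewrite take_cat hA ltnNge leqW ?(ltnW hc) //= subSn // ltnW.
have dropE r : drop (phi (xedge n k.+1)) (A ++ r :: B) =
    drop (phi (xedge n k.+1) - c).-1 B.
  rewrite drop_cat hA ltnNge ltnW //=.
  by have /prednK <- : 0 < phi (xedge n k.+1) - c by rewrite subn_gt0.
split; first by rewrite hx hp hq !dropE.
exists ([seq rcons P (yedge n k) | P <- drop (phi (xedge n k)) (prefixes phi k)] ++
  [seq rcons P (xedge n k.+1) | P <- A]).
exists (rcons p (xedge n k.+1)), (rcons q (xedge n k.+1)).
exists [seq rcons P (xedge n k.+1) | P <- take (phi (xedge n k.+1) - c) B].
split.
- by rewrite prefixesSS hp takeE map_cat catA.
- by rewrite prefixesSS -hd hx hq takeE map_cat catA.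
- by rewrite size_cat !size_map hA.
by apply: contra hpq => /eqP/rcons_inj[->].
Qed.

Lemma differ_at_branching n (phi phi' : {ffun edge n.+3 -> nat}) k :
    0 < k < n.+2 -> differ_at phi phi' k (phi (xedge n k.+1)) ->
  branching phi phi'.
Proof.
move=> hk [_ [A [p [q [B [hp hq hA hpq]]]]]]; exists k.+1, p; split=> //.
- by rewrite hp take_cat hA ltnNge leqnSn /= subSnn /= take0 mem_cat inE eqxx orbT.
- by rewrite hp drop_cat hA ltnn subnn inE eqxx.
(* The list of [phi'] consists of [A], [q] and [B]; [A] and [B] avoid [p] because the list of [phi]
   has no repetitions. *)
have := uniq_prefixes phi k.+1; rewrite hp hq cat_uniq /= negb_or mem_cat inE.
by case/and3P => _ /andP[/negPf -> _] /andP[/negPf -> _]; rewrite (negPf hpq).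
Qed.

(** Strong induction on the number m of inner vertices after k+1. The sign of the offset c -
    phi(x_(k+1)) selects the slack, nonslack or branching case. *)
Lemma differ_at_offsets n (phi phi' : {ffun edge n.+3 -> nat}) m k c :
    flow_equations phi ->
    (forall j, k < j < n.+3 -> phi' (xedge n j) = phi (xedge n j)) ->
    0 < k -> m + k = n.+1 -> differ_at phi phi' k c ->
  let s := offsets_from phi m k.+1 (c%:Z - (phi (xedge n k.+1))%:Z)%R in
  (Some (0%R : int) \in s -> branching phi phi') /\
  (Some (0%R : int) \notin s -> exchanged (routes phi) (routes phi')).
Proof.
move=> hphi; elim/ltn_ind: m k c => m IH k c hx k0 hm hdiff /=.
have hx1 : phi' (xedge n k.+1) = phi (xedge n k.+1) by apply: hx; lia.
have [zlt|zgt|z0] := ltngtP c (phi (xedge n k.+1)); last first.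
- have -> : offsets_from phi m k.+1 (c%:Z - (phi (xedge n k.+1))%:Z)%R = nseq m.+1 (Some 0%R).
    by rewrite -z0 subrr; case: m {IH hm}.
  split=> [_|]; last by rewrite mem_nseq eqxx.
  by subst c; apply: (differ_at_branching _ hdiff); lia.
- have zn0 : (c%:Z - (phi (xedge n k.+1))%:Z)%R != 0%R by lia.
  have zp : (c%:Z - (phi (xedge n k.+1))%:Z < 0)%R = false by lia.
  (* From n+2 and n+1 the nonslack edge leads straight to the sink, so in the first two cases one
     route changes and the sequence ends. *)
  case: m IH hm => [|[|m]] IH hm; rewrite /= (negPf zn0) ?zp.
  + have zn : Some (0%R : int) \notin [:: Some (c%:Z - (phi (xedge n k.+1))%:Z)%R].
      by rewrite inE eq_sym.
    rewrite (negPf zn); split=> // _; have {hm} ? : k = n.+1 by lia.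
    subst k; rewrite /routes (differ_at_prefixes_eq hx1 zgt hdiff).
    case: hdiff => _ [A [p [q [B [-> -> hA hpq]]]]].
    rewrite hx1 !drop_cat hA zgt !map_cat /= !catA; apply: exchanged_at => //.
    by apply: contra hpq => /eqP/rcons_inj[->].
  + have zn : Some (0%R : int) \notin [:: Some (c%:Z - (phi (xedge n k.+1))%:Z)%R; None].
      by rewrite !inE orbF eq_sym.
    rewrite (negPf zn); split=> // _; have {hm} ? : k = n by lia.
    subst k; apply: (@differ_at_routes _ _ _ (c - phi (xedge n n.+1))).
    by apply: differ_at_nonslack => //; apply: hx; lia.
  rewrite in_cons [_ == _ :> option _]eq_sym (inj_eq Some_inj) (negPf zn0) in_cons /=.
  rewrite flow_xE; last by lia.
  have -> : (c%:Z - (phi (xedge n k.+1))%:Z - (phi (xedge n k.+3))%:Z)%R =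
      ((c - phi (xedge n k.+1))%N%:Z - (phi (xedge n k.+3))%:Z)%R by lia.
  apply: (IH m _ k.+2); try lia.
  + by move=> j hj; apply: hx; lia.
  by apply: differ_at_nonslack => //; apply: hx; lia.
have zn0 : (c%:Z - (phi (xedge n k.+1))%:Z)%R != 0%R by lia.
have zp : (c%:Z - (phi (xedge n k.+1))%:Z < 0)%R by lia.
have hdiff' := differ_at_slack hx1 zlt hdiff.
case: m IH hm => [|m] IH hm; rewrite /= (negPf zn0) ?zp.
  have zn : Some (0%R : int) \notin [:: Some (c%:Z - (phi (xedge n k.+1))%:Z)%R].
    by rewrite inE eq_sym.
  rewrite (negPf zn); split=> // _; have {hm} ? : k = n.+1 by lia.
  by subst k; apply: differ_at_routes hdiff'.
rewrite in_cons [_ == _ :> option _]eq_sym (inj_eq Some_inj) (negPf zn0) /=.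
rewrite flow_yE; last by lia.
move: hdiff'; rewrite size_drop size_prefixes //; last by lia.
rewrite subSn ?leq_addr // addKn => hdiff'.
(* Conservation at k+2 matches the new position, shifted by phi(y_k) + 1, with the rule z_(j+1) =
   z_j + phi(y_(j+1)). *)
have -> : (c%:Z - (phi (xedge n k.+1))%:Z + (phi (yedge n k.+2))%:Z)%R =
    (((phi (yedge n k)).+1 + c)%N%:Z - (phi (xedge n k.+2))%:Z)%R.
  by case: hphi => _ _ _ /(_ k); lia.
apply: (IH m) hdiff'; try lia.
by move=> j hj; apply: hx; lia.
Qed.

(** * The first difference made by the move *)

Lemma eq_prefixes n (phi phi' : {ffun edge n.+3 -> nat}) i j :
    (forall k, 0 < k < i -> phi' (xedge n k) = phi (xedge n k)) -> 1 < i -> j <= i ->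
  prefixes phi' j = prefixes phi j.
Proof.
move=> hx hi; elim/ltn_ind: j => -[|[|k]] IH hk //; rewrite !prefixesSS !IH; try lia.
rewrite (hx k.+1); last by lia.
case: k IH hk => [|k] IH hk; last by rewrite (hx k.+1) //; lia.
by rewrite -[xedge n 0]/(xedge n 1) hx.
Qed.

(** At i, the prefix [p] at position phi(x_i) stops continuing along x_i, and its predecessor [p0]
    starts continuing along y_i. So the list at i+1 loses its last entry [u], the list at i+2 gains
    a first entry [v], and at i+3 the extension of [u] by y_(i+1) gives way to that of [v] by
    x_(i+2). *)
Lemma move_offsets n (phi phi' : {ffun edge n.+3 -> nat}) i :
    flow_equations phi -> 1 < i < n.+3 -> move i phi = Some phi' ->
  (Some (0%R : int) \in offsets i phi -> branching phi phi') /\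
  (Some (0%R : int) \notin offsets i phi -> exchanged (routes phi) (routes phi')).
Proof.
move=> hphi hi hmove; have [xpos ypos hx hy] := moveE hi hmove.
have prefE j : j <= i -> prefixes phi' j = prefixes phi j.
  move=> hj; apply: (eq_prefixes (i := i)) => //; last by lia.
  by move=> k hk; rewrite hx; do ?case: eqP; lia.
(* From here on the move is made at vertex i+2. *)
case: i hi hmove xpos ypos hx hy prefE => [//|[//|i]] hi hmove xpos ypos hx hy prefE.
have szL := size_prefixes hphi (j := i.+2) ltac:(lia).
have [A [p0 [p [B [hL hA]]]]] : exists A p0 p B,
    prefixes phi i.+2 = A ++ p0 :: p :: B /\ (size A).+1 = phi (xedge n i.+2).
  exists (take (phi (xedge n i.+2)).-1 (prefixes phi i.+2)).
  exists (nth [::] (prefixes phi i.+2) (phi (xedge n i.+2)).-1).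
  exists (nth [::] (prefixes phi i.+2) (phi (xedge n i.+2))).
  exists (drop (phi (xedge n i.+2)).+1 (prefixes phi i.+2)).
  rewrite -drop_nth; last by lia.
  split; last by rewrite size_takel; lia.
  by rewrite -{3}(prednK xpos) -drop_nth ?cat_take_drop //; lia.
have hxi : phi' (xedge n i.+2) = (phi (xedge n i.+2)).-1 by rewrite hx ?eqxx.
pose u := rcons p (xedge n i.+2); pose v := rcons p0 (yedge n i.+2).
have [M hM hM'] : exists2 M, prefixes phi i.+3 = rcons M u & prefixes phi' i.+3 = M.
  exists (prefixes phi' i.+3) => //; rewrite !(prefixesSS _ i.+1) !prefE //.
  rewrite hL hxi -hA (_ : phi' (xedge n i.+1) = phi (xedge n i.+1)); last first.
    by rewrite hx; do ?case: eqP; lia.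
  rewrite !take_cat /= !ltnNge !leqnSn ltnW //= subSnn -[(size A).+2]addn2 addKn /= take0.
  by rewrite !map_cat /= !rcons_cat.
have dropE : drop (phi (xedge n i.+2)) (prefixes phi i.+2) = p :: B.
  by rewrite hL -hA drop_cat ltnNge leqnSn subSnn.
have dropE' : drop (phi' (xedge n i.+2)) (prefixes phi' i.+2) = p0 :: p :: B.
  by rewrite prefE // hL hxi -hA drop_cat ltnn subnn.
have uv f g : f != g -> rcons u f != rcons v g.
  by move=> hfg; apply: contra hfg => /eqP/rcons_inj[_ ->].
(* At the last inner vertex, [u] and [v] already end at the sink. *)
rewrite /offsets /=; case: (leqP n.+2 i.+2) => hin.
  split=> // _; have ? : i = n by lia.
  subst i; rewrite /routes hM hM' dropE dropE' /= -cats1 -catA cat1s.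
  by apply: exchanged_at => //; apply/eqP => /rcons_inj[].
have ypos' := ypos ltac:(lia).
have hx3 : phi' (xedge n i.+3) = phi (xedge n i.+3).
  by rewrite hx; do ?case: eqP; lia.
have szM : size M = phi (xedge n i.+3) + phi (yedge n i.+3).
  by apply: succn_inj; rewrite -size_prefixes ?hM ?size_rcons //; lia.
(* Positivity of phi(y_(i+3)) keeps the last entry [u] out of the segment continued by x_(i+3). *)
have takeE : take (phi (xedge n i.+3)).+1 (rcons M u) = take (phi (xedge n i.+3)).+1 M.
  by rewrite -cats1 takel_cat // szM; lia.
have dropM : drop (phi (xedge n i.+3)) (rcons M u) = rcons (drop (phi (xedge n i.+3)) M) u.
  by rewrite drop_rcons // szM; lia.
have hN : prefixes phi' i.+4 = v :: prefixes phi i.+4.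
  by rewrite !(prefixesSS _ i.+2) dropE dropE' hM hM' hx3 takeE.
have zn0 : (flow_y phi i.+3 == 0%R) = false by rewrite flow_yE; lia.
have zp : (flow_y phi i.+3 < 0)%R = false by rewrite flow_yE; lia.
have hdiff : i.+4 < n.+3 -> differ_at phi phi' i.+4 (phi (yedge n i.+3)).
  move=> hi4; have hx4 : phi' (xedge n i.+4) = (phi (xedge n i.+4)).+1.
    by rewrite hx; do ?case: eqP; lia.
  split; first by rewrite hN hx4.
  exists [seq rcons P (yedge n i.+3) | P <- drop (phi (xedge n i.+3)) M].
  exists (rcons u (yedge n i.+3)), (rcons v (xedge n i.+4)).
  exists [seq rcons P (xedge n i.+4) | P <- take (phi (xedge n i.+4)).+1 (prefixes phi i.+4)].
  split.
  - by rewrite prefixesSS hM dropM map_rcons cat_rcons.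
  - by rewrite prefixesSS hM' hN hx3 hx4.
  - by rewrite size_map size_drop szM addKn.
  by apply: uv.
(* In the first case the sink is i+4, where [v] ends; in the second it is i+5, where the difference
   appears. Otherwise the offsets continue from position phi(y_(i+3)) at i+5. *)
case hm: (n.+2 - i.+3) => [|[|m]]; rewrite /= zn0 ?zp.
- rewrite inE [_ == _ :> option _]eq_sym (inj_eq Some_inj) zn0; split=> // _.
  have ? : n = i.+1 by lia.
  subst n; rewrite /routes hN hM hM' hx3 dropM map_rcons -cats1 catA.
  rewrite -[(v :: _) ++ _]/([::] ++ v :: _); apply: exchanged_at; first by rewrite cats0.
  by apply/eqP => /rcons_inj/(congr1 snd)/eqP; rewrite yedge_eq; lia.
- rewrite !inE orbF [_ == _ :> option _]eq_sym (inj_eq Some_inj) zn0; split=> // _.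
  have ? : n = i.+2 by lia.
  by subst n; apply: differ_at_routes (hdiff _).
rewrite in_cons [_ == _ :> option _]eq_sym (inj_eq Some_inj) zn0 in_cons /=.
rewrite flow_yE ?flow_xE; [|lia|lia].
apply: (differ_at_offsets hphi _ _ _ (hdiff _)); try lia.
by move=> j hj; rewrite hx; do ?case: eqP; lia.
Qed.

(** * Adjacency and offsets *)

Local Open Scope ring_scope.

Theorem theorem7 (R : realType) (n i : nat)
    (hn : (3 <= n)%N) (hi : (2 <= i <= n.-1)%N)
    (phi phi' : {ffun edge n -> nat})
    (hphi : integer_flow phi) (hmove : move i phi = Some phi')
    (D D' : set {ffun edge n -> R})
    (hD : corresponding D phi) (hD' : corresponding D' phi') :
  dual_adjacent D D' <-> Some (0 : int) \notin offsets i phi.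
Proof.
case: n hn hi phi phi' hphi hmove D D' hD hD' => [|[|[|n]]] // _ hi phi phi'.
move=> /integer_flow_equations hphi hmove D D' [C [mC -> hC]] [C' [mC' -> hC']].
have hphi' := move_flow_equations hi hmove hphi.
have [zero nonzero] := move_offsets hphi hi hmove.
split=> [/(dual_adjacentE R mC mC')[_ [r [r' [_ _ hrr']]]]|/nonzero hex].
  apply/negP => /zero hbr.
  exact: (branching_not_adjacent hphi mC hC hphi' mC' hC' hbr hrr').
by apply/(dual_adjacentE R mC mC')/(exchanged_adjacent hphi mC hC hphi' mC' hC').
Qed.
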